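(* For any $n$ and any decoration $\delta \in \{\mathsf N,\mathsf D,\mathsf U,\mathsf X\}^n$, the $\delta$-permutree congruence $\equiv_\delta$ is a lattice congruence of the weak order on the set $\mathfrak S^\delta$ of permutations of $[n]$ decorated by $\delta$.
   Context: $[n]=\{1,\dots,n\}$. A decoration of size $n$ is a word $\delta=\delta_1\cdots\delta_n$ in the four symbols $\mathsf N$ (none), $\mathsf D$ (down), $\mathsf U$ (up), $\mathsf X$ (both up and down). $\mathfrak S^\delta$ is the set of permutations $\tau=\tau_1\cdots\tau_n$ of $[n]$ (written as words) in which each value $b$ carries the decoration $\delta_b$; as a set it is identified with $\mathfrak S_n$. The $\delta$-permutree congruence $\equiv_\delta$ is the equivalence relation on $\mathfrak S^\delta$ generated by the rewriting rules $UacVbW \equiv_\delta UcaVbW$ if $a<b<c$ and $\delta_b\in\{\mathsf D,\mathsf X\}$, and $UbVacW \equiv_\delta UbVcaW$ if $a<b<c$ and $\delta_b\in\{\mathsf U,\mathsf X\}$, where $a,b,c\in[n]$ and $U,V,W$ are words on $[n]$. The (right) weak order on $\mathfrak S_n$ is the inclusion order of inversion sets, where an inversion of $\tau$ is a pair of values $i<j$ with $\tau^{-1}(i)>\tau^{-1}(j)$; it is a lattice. A lattice congruence of a lattice $(L,\le,\wedge,\vee)$ is an equivalence relation $\equiv$ such that $x\equiv x'$ and $y\equiv y'$ imply $x\wedge y\equiv x'\wedge y'$ and $x\vee y\equiv x'\vee y'$. *)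

(* Defs.v *)
From HB Require Import structures.
From Stdlib Require Import Relation_Definitions Relation_Operators.
From mathcomp Require Import all_boot all_order all_fingroup.

Set Implicit Arguments.
Unset Strict Implicit.
Unset Printing Implicit Defensive.

Import Order.TTheory.

(* The ground set [n] is 'I_n (values and positions both start at 0).  A
   permutation s is the word (s 0) (s 1) ... (s n.-1): s maps positions to
   values, and s^-1 maps a value to its position. *)

Fact weak_display : Order.disp_t. Proof. exact: (Order.Disp tt tt). Qed.

Section WeakOrder.
Variable n : nat.
Implicit Types (s t u : 'S_n) (i j k : 'I_n).

Definition word s : seq 'I_n := [seq s i | i <- enum 'I_n].

Definition inversions s : {set 'I_n * 'I_n} :=
  [set p : 'I_n * 'I_n | (p.1 < p.2) && ((s^-1)%g p.2 < (s^-1)%g p.1)].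

Definition weak_le s t : bool := inversions s \subset inversions t.

Lemma mem_inv s i j :
  ((i, j) \in inversions s) = (i < j) && ((s^-1)%g j < (s^-1)%g i).
Proof. by rewrite inE. Qed.

Lemma pos_ltgt s i j : i != j -> ((s^-1)%g j < (s^-1)%g i) = ~~ ((s^-1)%g i < (s^-1)%g j).
Proof.
by case: ltngtP => // /val_inj /perm_inj -> /eqP.
Qed.

Lemma pos_card s i : #|[set j | (s^-1)%g j < (s^-1)%g i]| = (s^-1)%g i :> nat.
Proof.
rewrite -(card_imset _ (@perm_inj _ (s^-1)%g)).
have -> : [set (s^-1)%g x | x in [set j | (s^-1)%g j < (s^-1)%g i]]
          = [set k : 'I_n | k < (s^-1)%g i].
  apply/setP=> k; rewrite inE; apply/imsetP/idP => [[x]|ki].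
    by rewrite inE => h ->.
  by exists (s k); rewrite ?inE permK.
have := ltnW (ltn_ord ((s^-1)%g i)); move: (val _) => m mn.
rewrite cardsE -sum1_card (eq_bigl (fun k : 'I_n => k < m)) //.
by rewrite (big_ord_narrow mn) sum1_card card_ord.
Qed.

Lemma inversions_inj : injective inversions.
Proof.
move=> s t st; apply: invg_inj; apply/permP=> i; apply: val_inj => /=.
rewrite -(pos_card s i) -(pos_card t i); apply: eq_card => j; rewrite !inE.
have inv_st (a b : 'I_n) : a < b -> ((s^-1)%g b < (s^-1)%g a) = ((t^-1)%g b < (t^-1)%g a).
  by move=> ab; have := mem_inv s a b; rewrite st mem_inv ab.
case: (ltngtP i j) => [ij|ji|/val_inj ->]; last by rewrite !ltnn.
  exact: inv_st.
have ij : i != j by apply: contraTneq ji => ->; rewrite ltnn.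
by rewrite (pos_ltgt s ij) (pos_ltgt t ij) inv_st.
Qed.

Lemma weak_le_refl : reflexive weak_le. Proof. by move=> s; exact: subxx. Qed.

Lemma weak_le_anti : antisymmetric weak_le.
Proof. by move=> s t; rewrite /weak_le -eqEsubset => /eqP /inversions_inj. Qed.

Lemma weak_le_trans : transitive weak_le.
Proof. by move=> t s u; exact: subset_trans. Qed.

Lemma inv_trans s i j k : (i, j) \in inversions s -> (j, k) \in inversions s ->
  (i, k) \in inversions s.
Proof.
rewrite !mem_inv => /andP[ij sji] /andP[jk skj].
by rewrite (ltn_trans ij jk) (ltn_trans skj sji).
Qed.

Lemma inv_cotrans s i j k : i < j -> j < k -> (i, k) \in inversions s ->
  ((i, j) \in inversions s) || ((j, k) \in inversions s).
Proof.
move=> ij jk; rewrite !mem_inv ij jk /= => /andP[_ ski].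
case: (ltnP ((s^-1)%g j) ((s^-1)%g i)) => //= sij.
exact: leq_trans ski sij.
Qed.

Definition biclosed (A : {set 'I_n * 'I_n}) :=
  [/\ forall i j, (i, j) \in A -> i < j,
      forall i j k, (i, j) \in A -> (j, k) \in A -> (i, k) \in A &
      forall i j k, i < j -> j < k -> (i, k) \in A ->
        ((i, j) \in A) || ((j, k) \in A)].

Lemma biclosed_inversions (A : {set 'I_n * 'I_n}) :
  biclosed A -> exists u, inversions u = A.
Proof.
case=> Alt Atr Aco.
pose lt i j := ((i < j) && ((i, j) \notin A)) || ((j, i) \in A).
have ltnn' i : ~~ lt i i.
  by rewrite /lt ltnn /=; apply/negP => /Alt; rewrite ltnn.
have lt_tot i j : i != j -> lt j i = ~~ lt i j.
  move=> ij; rewrite /lt; case: (ltngtP i j) => [h|h|/val_inj h] /=.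
  - have /negbTE -> : (j, i) \notin A by apply/negP=> /Alt; rewrite ltnNge ltnW.
    by rewrite orbF negbK.
  - have /negbTE -> : (i, j) \notin A by apply/negP=> /Alt; rewrite ltnNge ltnW.
    by rewrite orbF.
  - by rewrite h eqxx in ij.
have lt_tr j i k : lt i j -> lt j k -> lt i k.
  move=> /orP[/andP[ij nij]|ji] /orP[/andP[jk njk]|kj]; rewrite /lt.
  - rewrite (ltn_trans ij jk) /=; apply/orP; left; apply/negP=> /Aco.
    by move=> /(_ j ij jk); rewrite (negbTE nij) (negbTE njk).
  - case: (ltngtP i k) => [ik|ki|/val_inj ik] /=.
    + apply/orP; left; apply: contra nij => ik'; exact: Atr ik' kj.
    + by case/orP: (Aco _ _ _ ki ij kj) => // ij'; rewrite ij' in nij.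
    + by rewrite ik kj in nij.
  - case: (ltngtP i k) => [ik|ki|/val_inj ik] /=.
    + apply/orP; left; apply: contra njk => ik'; exact: Atr ji ik'.
    + by case/orP: (Aco _ _ _ jk ki ji) => // jk'; rewrite jk' in njk.
    + by rewrite -ik ji in njk.
  - by rewrite (Atr _ _ _ kj ji) orbT.
pose pos i := #|[set j | lt j i]|.
have pos_lt i j : lt i j -> pos i < pos j.
  move=> ij; apply: proper_card; apply/properP; split.
    by apply/subsetP=> k; rewrite !inE => ki; exact: lt_tr ki ij.
  by exists i; rewrite inE // ltnn'.
have posE i j : (pos i < pos j) = lt i j.
  apply/idP/idP => [pij|]; last exact: pos_lt.
  apply/negPn/negP => nij; case: (eqVneq i j) => [ij|ij].
    by rewrite ij ltnn in pij.
  move: nij; rewrite -lt_tot // => /pos_lt.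
  by rewrite ltnNge ltnW.
have pos_n i : pos i < n.
  rewrite -[X in _ < X]card_ord -cardsT; apply: proper_card.
  by apply/properP; split; [exact: subsetT | exists i; rewrite ?inE // ltnn'].
pose f i := Ordinal (pos_n i).
have f_inj : injective f.
  move=> i j /(congr1 val) /= pij; apply/eqP; apply/negPn/negP => ij.
  by have := lt_tot i j ij; rewrite -!posE pij ltnn.
exists (perm f_inj)^-1%g; apply/setP=> -[i j].
rewrite mem_inv invgK !permE /= posE /lt.
apply/andP/idP => [[ij]|Aij].
  by rewrite [j < i]ltnNge (ltnW ij).
by rewrite Aij orbT (Alt _ _ Aij).
Qed.

(* Transitive closure of the union of the two inversion sets. *)
Definition join_inversions s t : {set 'I_n * 'I_n} :=
  [set p : 'I_n * 'I_n | (p.1 < p.2) &&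
    connect (fun i j => (i, j) \in inversions s :|: inversions t) p.1 p.2].

Lemma biclosed_join s t : biclosed (join_inversions s t).
Proof.
set e := fun i j : 'I_n => (i, j) \in inversions s :|: inversions t.
have JE i j : ((i, j) \in join_inversions s t) = (i < j) && connect e i j.
  by rewrite inE.
have e_lt i j : e i j -> i < j by rewrite /e in_setU !mem_inv => /orP[]/andP[].
split=> [i j|i j k|i j k ij jk]; rewrite !JE.
- by case/andP.
- move=> /andP[ij cij] /andP[jk cjk].
  by rewrite (ltn_trans ij jk) (connect_trans cij cjk).
rewrite ij jk /= => /andP[_] /connectP[p].
elim: p i ij => [|x p IH] i ij /=; first by move=> _ ki; rewrite ki ltnNge ltnW in jk.
case/andP=> ix px kE.
have xk : connect e x k by apply/connectP; exists p.
case: (ltngtP x j) => [xj|jx|/val_inj <-]; last by rewrite connect1.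
- case/orP: (IH x xj px kE) => [xj'|->]; last by rewrite orbT.
  by rewrite (connect_trans (connect1 ix) xj').
- have /orP[h|h] : e i j || e j x.
    move: ix; rewrite /e !in_setU.
    by case/orP=> /(inv_cotrans ij jx) /orP[] ->; rewrite ?orbT.
  + by rewrite connect1.
  + by rewrite (connect_trans (connect1 h) xk) orbT.
Qed.

(* Such a u always exists (inversions_join): the default s is never used. *)
Definition weak_join s t : 'S_n :=
  odflt s [pick u | inversions u == join_inversions s t].

Lemma inversions_join s t : inversions (weak_join s t) = join_inversions s t.
Proof.
rewrite /weak_join; case: pickP => [u /eqP //|no].
by have [u /eqP] := biclosed_inversions (biclosed_join s t); rewrite no.
Qed.

Lemma weak_joinP s t u :
  weak_le (weak_join s t) u = weak_le s u && weak_le t u.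
Proof.
rewrite /weak_le inversions_join -subUset.
apply/idP/idP => [le|le]; apply/subsetP=> -[i j] ij.
  apply: (subsetP le); rewrite inE /= (connect1 ij) andbT.
  by move: ij; rewrite in_setU !mem_inv => /orP[]/andP[].
move: ij; rewrite inE /= => /andP[ij /connectP[p]].
elim: p i ij => [|x p IH] i ij /=; first by move=> _ ji; rewrite ji ltnn in ij.
case/andP=> /(subsetP le) ix px jE.
case: (ltngtP x j) => [xj|jx|/val_inj <- //].
  exact: inv_trans ix (IH x xj px jE).
have : x <= j.
  rewrite jE; elim: (p) (x) px => //= y q IHq z /andP[/(subsetP le)].
  by rewrite mem_inv => /andP[zy _] /IHq; apply: leq_trans; exact: ltnW.
by rewrite leqNgt jx.
Qed.

(* Reading words from right to left complements inversion sets, hence reverses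
   the weak order; meets are obtained from joins through this duality. *)
Definition weak_rev s : 'S_n := ((s^-1 * perm (@rev_ord_inj n))^-1)%g.

Lemma weak_revK : involutive weak_rev.
Proof.
move=> s; rewrite /weak_rev invgK -mulgA; apply: invg_inj; rewrite invgK.
by apply/permP=> i; rewrite !permM !(permE (@rev_ord_inj n)) rev_ordK.
Qed.

Lemma mem_inv_rev s i j :
  ((i, j) \in inversions (weak_rev s)) = (i < j) && ((i, j) \notin inversions s).
Proof.
rewrite !mem_inv invgK !permM !(permE (@rev_ord_inj n)) /=.
case: (ltngtP i j) => //= ij; rewrite ltn_sub2lE // ltnS.
have ji : j != i by apply: contraTneq ij => ->; rewrite ltnn.
exact: (pos_ltgt s ji).
Qed.

Lemma weak_le_rev s t : weak_le (weak_rev s) (weak_rev t) = weak_le t s.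
Proof.
have rev s' t' : weak_le t' s' -> weak_le (weak_rev s') (weak_rev t').
  move=> le; apply/subsetP=> -[i j]; rewrite !mem_inv_rev => /andP[-> /=].
  exact/contra/(subsetP le).
by apply/idP/idP => /rev //; rewrite !weak_revK.
Qed.

Definition weak_meet s t : 'S_n := weak_rev (weak_join (weak_rev s) (weak_rev t)).

Lemma weak_meetP s t u :
  weak_le s (weak_meet t u) = weak_le s t && weak_le s u.
Proof.
by rewrite -{1}(weak_revK s) weak_le_rev weak_joinP !weak_le_rev.
Qed.

End WeakOrder.

Variant decoration := DecN | DecD | DecU | DecX.

Definition is_down (x : decoration) : bool :=
  match x with DecD | DecX => true | DecN | DecU => false end.

Definition is_up (x : decoration) : bool :=
  match x with DecU | DecX => true | DecN | DecD => false end.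

(* The decoration attached to each value is determined by delta, so that
   decorated permutations are permutations tagged by delta. *)
Definition decorated_perm n (delta : n.-tuple decoration) : Type := 'S_n.

HB.instance Definition _ n (delta : n.-tuple decoration) :=
  Finite.copy (decorated_perm delta) 'S_n.
HB.instance Definition _ n (delta : n.-tuple decoration) :=
  Order.Le_isPOrder.Build weak_display (decorated_perm delta)
    (@weak_le_refl n) (@weak_le_anti n) (@weak_le_trans n).
HB.instance Definition _ n (delta : n.-tuple decoration) :=
  Order.POrder_MeetJoin_isLattice.Build weak_display (decorated_perm delta)
    (@weak_meetP n) (@weak_joinP n).

Variant permutree_rule n (delta : n.-tuple decoration)
    (s t : decorated_perm delta) : Prop :=
  | PermutreeDown (U V W : seq 'I_n) (a b c : 'I_n) of
      a < b & b < c & is_down (tnth delta b) &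
      word s = U ++ [:: a; c] ++ V ++ [:: b] ++ W &
      word t = U ++ [:: c; a] ++ V ++ [:: b] ++ W
  | PermutreeUp (U V W : seq 'I_n) (a b c : 'I_n) of
      a < b & b < c & is_up (tnth delta b) &
      word s = U ++ [:: b] ++ V ++ [:: a; c] ++ W &
      word t = U ++ [:: b] ++ V ++ [:: c; a] ++ W.

Arguments permutree_rule {n} delta s t.

Definition permutree_congruence n (delta : n.-tuple decoration) :
    relation (decorated_perm delta) :=
  clos_refl_sym_trans _ (permutree_rule delta).

Arguments permutree_congruence {n} delta _ _.

Definition lattice_congruence d (L : latticeType d) (E : relation L) : Prop :=
  equivalence L E /\
  forall x x' y y' : L, E x x' -> E y y' ->
    E (x `&` y)%O (x' `&` y')%O /\ E (x `|` y)%O (x' `|` y')%O.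

(* Main.v *)
Require Import Defs.
From HB Require Import structures.
From Stdlib Require Import Relation_Operators.
From mathcomp Require Import all_boot all_order all_fingroup.
From mathcomp Require Import zify.

(** Each value [b] that is decorated down contributes its own family of
    rewritings, and so does each value decorated up; the congruence is the
    equivalence relation generated by all of these families. An equivalence
    relation that is generated by lattice congruences is again a lattice
    congruence, so a single family suffices.

    Fix [b], decorated down. A rewriting adds one inversion [(a, c)] with
    [a < b < c], where [c], and hence also [a], stands before [b]. Such an [(a, c)] is
    recognised from the inversion [(b, c)] alone, so the largest word that can
    be reached from [s] should have the inversion set
    [inversions s] + { [(a, c)] : [a < b < c] and [(b, c)] is an inversion of [s] },
    which is [straddle_closure false b (inversions s)]. For [b] decorated up the
    test is on [(a, b)] instead. Three facts make this work.
    - It is a closure operator on sets of pairs that preserves inversion sets of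
      permutations ([biclosed_straddle_closure]), hence a closure operator on
      the weak order.
    - It does not change along a rewriting at [b] ([straddle_closure_swap]).
    - Every permutation is linked by rewritings at [b] to its closure
      ([congruence_straddle_closure]): if the closure is not reached yet, a
      missing pair whose two entries are as close as possible is adjacent
      ([exists_adjacent_straddle]), and can be swapped.
    For any closure operator on a lattice, the closure of a join depends only on
    the closures of the joined elements ([straddle_closure_join]). Hence
    rewriting [x] into [x'] leaves the closure of [x \/ y] unchanged, and
    [x \/ y] and [x' \/ y] are both congruent to that closure.

    Meets follow from joins by reading words from right to left. This reverses
    the weak order and turns the rewritings for [delta] into those for the
    decoration that exchanges up and down ([congruence_rev]). *)

Set Implicit Arguments.
Unset Strict Implicit.
Unset Printing Implicit Defensive.

(** * The closure operator attached to one decorated value *)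

Section Straddle.
Variable n : nat.
Implicit Types (A B : {set 'I_n * 'I_n}) (s t u x y : 'S_n) (i j k a b c : 'I_n).

(** The inversions of the largest word reachable by rewritings at [b]. The flag
    [up] selects the kind of decoration: for up, [a] and [c] must stand after
    [b], which the inversion [(a, b)] witnesses because [a < b], while [c]
    follows unless [(a, c)] is already inverted; for down, [(b, c)] is the
    witness in the same way. *)
Definition straddle_closure (up : bool) b A : {set 'I_n * 'I_n} :=
  A :|: [set p : 'I_n * 'I_n |
    (p.1 < b < p.2) && ((if up then (p.1, b) else (b, p.2)) \in A)].

Lemma mem_straddle_closure up b A i k :
  ((i, k) \in straddle_closure up b A) =
  ((i, k) \in A) || (i < b < k) && ((if up then (i, b) else (b, k)) \in A).
Proof. by rewrite !inE. Qed.

Lemma straddle_closure_id up b A i k :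
  ~~ (i < b < k) -> ((i, k) \in straddle_closure up b A) = ((i, k) \in A).
Proof. by move=> /negbTE ibk; rewrite mem_straddle_closure ibk orbF. Qed.

Lemma sub_straddle_closure up b A : A \subset straddle_closure up b A.
Proof. exact: subsetUl. Qed.

Lemma straddle_closureS up b A B :
  A \subset B -> straddle_closure up b A \subset straddle_closure up b B.
Proof.
move=> /subsetP AB; apply/subsetP=> -[i k]; rewrite !mem_straddle_closure.
by case/orP=> [/AB->//|/andP[-> /AB->]]; rewrite orbT.
Qed.

(** The pairs tested by the definition have [b] as an entry, and no pair added
    by the closure does. *)
Lemma straddle_closureK up b A :
  straddle_closure up b (straddle_closure up b A) = straddle_closure up b A.
Proof.
apply/setP=> -[i k]; rewrite mem_straddle_closure mem_straddle_closure -orbA.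
congr (_ || _); case: up; rewrite straddle_closure_id ?orbb //;
  by rewrite ltnn ?andbF.
Qed.

Lemma biclosed_straddle_closure up b A :
  biclosed A -> biclosed (straddle_closure up b A).
Proof.
case=> Alt Atr Aco; split=> [i k|i j k|i j k ij jk]; rewrite !mem_straddle_closure.
- by case/orP=> [/Alt //|/andP[/andP[ib bk] _]]; apply: ltn_trans ib bk.
- case: up.
  + case/orP=> [Aij|/andP[/andP[ib bj] Aib]].
      case/orP=> [Ajk|/andP[/andP[jb bk] Ajb]]; first by rewrite (Atr _ _ _ Aij Ajk).
      by rewrite bk (ltn_trans (Alt _ _ Aij) jb) (Atr _ _ _ Aij Ajb) orbT.
    have H : j < k -> i < b < k by move=> jk; rewrite ib (ltn_trans bj jk).
    by case/orP=> [/Alt/H->|/andP[/andP[jb bk] _]]; rewrite ?ib ?bk ?Aib ?orbT.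
  + case/orP=> [Aij|/andP[/andP[ib bj] Abj]].
      case/orP=> [Ajk|/andP[/andP[jb bk] Abk]]; first by rewrite (Atr _ _ _ Aij Ajk).
      by rewrite bk (ltn_trans (Alt _ _ Aij) jb) Abk orbT.
    case/orP=> [Ajk|/andP[/andP[jb bk] Abk]]; last by rewrite ib bk Abk orbT.
    by rewrite ib (ltn_trans bj (Alt _ _ Ajk)) (Atr _ _ _ Abj Ajk) orbT.
case/orP=> [/(Aco _ _ _ ij jk)/orP[]->|]; rewrite ?orbT //.
case/andP=> /andP[ib bk].
case: up => [Aib|Abk].
  case: (ltngtP j b) => [jb|bj|/val_inj ->]; last by rewrite Aib.
    by case/orP: (Aco _ _ _ ij jb Aib) => -> //; rewrite bk /= !orbT.
  by rewrite ib Aib /= orbT.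
case: (ltngtP j b) => [jb|bj|/val_inj ->]; last by rewrite Abk orbT.
  by rewrite bk Abk /= !orbT.
by case/orP: (Aco _ _ _ bj jk Abk) => ->; rewrite ?ib ?orbT.
Qed.

Lemma straddle_closure_inversions up b s :
  exists u, inversions u = straddle_closure up b (inversions s).
Proof.
apply/biclosed_inversions/biclosed_straddle_closure.
split=> [i j|i j k|i j k]; last exact: inv_cotrans.
  by rewrite mem_inv => /andP[].
exact: inv_trans.
Qed.

Lemma weak_le_join x y : weak_le x (weak_join x y) /\ weak_le y (weak_join x y).
Proof. by apply/andP; rewrite -weak_joinP weak_le_refl. Qed.

(** With [u] the permutation whose inversions are the closure of [x \/ y], both
    [x'] and [y] lie below [u], hence so does [x' \/ y]; the other inclusion is
    symmetric. *)
Lemma straddle_closure_join up b x x' y :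
    straddle_closure up b (inversions x) = straddle_closure up b (inversions x') ->
  straddle_closure up b (inversions (weak_join x y)) =
  straddle_closure up b (inversions (weak_join x' y)).
Proof.
wlog suff sub : x x' / straddle_closure up b (inversions x) =
    straddle_closure up b (inversions x') ->
    straddle_closure up b (inversions (weak_join x' y)) \subset
    straddle_closure up b (inversions (weak_join x y)).
  by move=> xx'; apply/eqP; rewrite eqEsubset !sub.
move=> xx'; have [x_le y_le] := weak_le_join x y.
have [u uE] := straddle_closure_inversions up b (weak_join x y).
rewrite -(straddle_closureK up b (inversions (weak_join x y))) -uE.
apply: straddle_closureS.
change (weak_le (weak_join x' y) u); rewrite weak_joinP /weak_le uE.
apply/andP; split; last exact: subset_trans y_le (sub_straddle_closure _ _ _).
apply: subset_trans (sub_straddle_closure up b _) _.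
by rewrite -xx'; apply: straddle_closureS.
Qed.

End Straddle.

(** * Words and swaps of adjacent entries *)

Section Words.
Variable n : nat.
Implicit Types (s t : 'S_n) (i j a b c : 'I_n).

Lemma size_word s : size (word s) = n.
Proof. by rewrite size_map size_enum_ord. Qed.

Lemma uniq_word s : uniq (word s).
Proof. by rewrite map_inj_uniq ?enum_uniq //; apply: perm_inj. Qed.

Lemma index_word s a : index a (word s) = (s^-1)%g a.
Proof.
by rewrite -{1}(permKV s a) /word index_map ?index_enum_ord //; exact: perm_inj.
Qed.

Lemma word_inj : injective (@word n).
Proof.
move=> s t st; apply: invg_inj; apply/permP=> a; apply: val_inj.
by rewrite /= -!index_word st.
Qed.

Lemma index_word_split s P a Q : word s = P ++ a :: Q -> (s^-1)%g a = size P :> nat.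
Proof.
move=> sE; have := uniq_word s; rewrite -index_word sE cat_uniq /=.
case/and3P=> _ /norP[aP _] _.
by rewrite index_cat (negbTE aP) /= eqxx addn0.
Qed.

Lemma word_split s a :
  word s = take ((s^-1)%g a) (word s) ++ a :: drop ((s^-1)%g a).+1 (word s).
Proof.
have ia : index a (word s) < size (word s) by rewrite index_word size_word.
have := cat_take_drop ((s^-1)%g a) (word s).
by rewrite (drop_nth a) -index_word ?nth_index -?index_mem // => ->.
Qed.

Lemma word_swap s U a c R : word s = U ++ a :: c :: R ->
  word (s * tperm a c)%g = U ++ c :: a :: R.
Proof.
move=> sE; have := uniq_word s; rewrite sE cat_uniq => /and3P[_ aU].
rewrite /= in_cons !negb_or => /and3P[/andP[ac aR] cR _].
have -> : word (s * tperm a c)%g = map (tperm a c) (word s).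
  by rewrite /word -[RHS]map_comp; apply: eq_map => i; rewrite /= permM.
have fixed P : a \notin P -> c \notin P -> map (tperm a c) P = P.
  move=> aP cP; apply: map_id_in => x xP.
  by rewrite tpermD //; [apply: contraNneq aP | apply: contraNneq cP] => ->.
move: aU; rewrite /= !negb_or => /and3P[aU cU _].
by rewrite sE map_cat /= tpermL tpermR !fixed.
Qed.

Lemma inversions_swap s a c : a < c -> (s^-1)%g c = ((s^-1)%g a).+1 :> nat ->
  inversions (s * tperm a c)%g = (a, c) |: inversions s.
Proof.
move=> ac sca; apply/setP=> -[i j].
rewrite in_setU1 !mem_inv invMg tpermV !permM xpair_eqE.
have [pos posE] : exists pos : 'I_n -> nat, forall p, (s^-1)%g p = pos p :> nat.
  by exists (fun p => nat_of_ord ((s^-1)%g p)).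
have pos_neq p q : p <> q -> pos p <> pos q.
  by rewrite -!posE => pq /val_inj/perm_inj.
have ca : (c == a) = false by apply/eqP => ca; rewrite ca ltnn in ac.
rewrite !posE in sca *.
case: (tpermP a c j) => [->|->|/[dup] /eqP/negbTE ja /pos_neq pja
                              /[dup] /eqP/negbTE jc /pos_neq pjc];
  case: (tpermP a c i) => [->|->|/[dup] /eqP/negbTE ia /pos_neq pia
                              /[dup] /eqP/negbTE ic /pos_neq pic];
  rewrite ?ltnn ?eqxx ?[a == c]eq_sym ?ca ?ja ?jc ?ia ?ic ?andbF ?andbT //=; lia.
Qed.

(** The swap adds only the pair [(a, c)], which the closure of [s] contains. *)
Lemma straddle_closure_swap up b s a c :
    a < b < c -> (a, c) \in straddle_closure up b (inversions s) ->
    (s^-1)%g c = ((s^-1)%g a).+1 :> nat ->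
  straddle_closure up b (inversions (s * tperm a c)%g) =
  straddle_closure up b (inversions s).
Proof.
move=> /andP[ab bc] acS sca; rewrite inversions_swap ?(ltn_trans ab bc) //.
apply/eqP; rewrite eqEsubset (straddle_closureS _ _ (subsetUr _ _)) andbT.
rewrite -(straddle_closureK up b (inversions s)); apply: straddle_closureS.
by rewrite subUset sub1set acS sub_straddle_closure.
Qed.

(** Among the pairs that the closure adds to the inversions of [s], take one
    whose entries [a] and [c] are at the smallest distance in the word. An entry
    [x] strictly between them is not [b], and replacing [c] by [x] if [x > b],
    or [a] by [x] if [x < b], would give a closer pair. *)
Lemma exists_adjacent_straddle up b s :
    ~~ (straddle_closure up b (inversions s) \subset inversions s) ->
  exists a c, [/\ a < b < c,
    (a, c) \in straddle_closure up b (inversions s) :\: inversions s &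
    (s^-1)%g c = ((s^-1)%g a).+1 :> nat].
Proof.
set D := _ :\: _; rewrite -setD_eq0 -/D => /set0Pn[p0 p0D].
case: (arg_minnP (fun p : 'I_n * 'I_n => (s^-1)%g p.2 - (s^-1)%g p.1) p0D).
move=> -[a c] /= acD gap_min.
have {}acD : (a, c) \in D := acD.
have {}gap_min i k : (i, k) \in D ->
    (s^-1)%g c - (s^-1)%g a <= (s^-1)%g k - (s^-1)%g i := gap_min (i, k).
(* The added pairs in terms of positions alone. *)
have DE i k : ((i, k) \in D) = [&& i < b < k, (s^-1)%g i < (s^-1)%g k &
    if up then (s^-1)%g b < (s^-1)%g i else (s^-1)%g k < (s^-1)%g b].
  rewrite in_setD mem_straddle_closure.
  case: (boolP (i < b < k)) => [/andP[ib bk]|_]; last by rewrite orbF andNb.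
  have ik := ltn_trans ib bk.
  have ki : k != i by apply: contraTneq ik => ->; rewrite ltnn.
  rewrite /= (fun_if (fun p => p \in inversions s)) !mem_inv ib bk ik /=.
  case: (ltngtP ((s^-1)%g i) ((s^-1)%g k)) => // /val_inj/perm_inj ik'.
  by rewrite ik' eqxx in ki.
have := acD; rewrite DE => /and3P[/andP[ab bc] sac upb].
exists a, c; rewrite ab bc; split=> //.
apply/eqP/negPn/negP => /eqP nadj.
have px : ((s^-1)%g a).+1 < n by apply: leq_ltn_trans sac (ltn_ord _).
pose x := s (Ordinal px).
have sx : (s^-1)%g x = ((s^-1)%g a).+1 :> nat by rewrite permK.
have := gap_min x c; have := gap_min a x; rewrite !DE /= sx.
move: upb {acD gap_min DE p0D} @D => upb _.
case: (ltngtP x b) => [xb|bx|/val_inj xb].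
- by case: up upb => h _; rewrite bc /=; lia.
- by case: up upb => h + _; rewrite ab /=; lia.
- by move: upb; rewrite -xb sx; case: up => ? _ _; lia.
Qed.

Lemma word_rev s : word (weak_rev s) = rev (word s).
Proof.
have -> : rev (word s) = [seq s i | i <- rev (enum 'I_n)] by rewrite /word map_rev.
have -> : rev (enum 'I_n) = [seq rev_ord i | i <- enum 'I_n].
  apply: (inj_map val_inj); rewrite map_rev val_enum_ord -[RHS]map_comp.
  apply: (@eq_from_nth _ 0) => [|i]; rewrite size_rev size_iota.
    by rewrite size_map size_enum_ord.
  move=> ni; rewrite nth_rev ?size_iota // nth_iota; last by lia.
  have i0 : 'I_n by exists i.
  by rewrite (nth_map i0) ?size_enum_ord //= nth_enum_ord // add0n.
rewrite /word -[RHS]map_comp; apply: eq_map => i /=.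
have /permP/(_ i) : (weak_rev s * s^-1 * perm (@rev_ord_inj n) = 1)%g.
  by rewrite /weak_rev -mulgA mulVg.
rewrite !permM perm1 (permE (@rev_ord_inj n)) => /(congr1 (@rev_ord n)).
by rewrite rev_ordK => <-; rewrite permKV.
Qed.

End Words.

(** * Compatibility with joins *)

Section Congruence.
Variable n : nat.
Implicit Types (delta : n.-tuple decoration) (s t u x y : 'S_n).

Definition carries (up : bool) (d : decoration) := if up then is_up d else is_down d.

Lemma permutree_rule_adjacent delta s t : permutree_rule delta s t ->
  exists (up : bool) (b a c : 'I_n), [/\ carries up (tnth delta b), a < b < c,
    (a, c) \in straddle_closure up b (inversions s),
    (s^-1)%g c = ((s^-1)%g a).+1 :> nat & t = (s * tperm a c)%g].
Proof.
have adj U V a c : word s = U ++ [:: a, c & V] -> (s^-1)%g c = ((s^-1)%g a).+1 :> nat.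
  move=> sE; rewrite (index_word_split sE).
  by rewrite -cat_rcons in sE; rewrite (index_word_split sE) size_rcons.
case=> U V W a b c ab bc db sE tE.
  exists false, b, a, c; rewrite ab bc mem_straddle_closure ab bc !mem_inv bc /=.
  split=> //; [apply/orP; right|exact: adj sE|by apply: word_inj; rewrite (word_swap sE)].
  have sb : word s = (U ++ [:: a, c & V]) ++ b :: W by rewrite sE -catA.
  rewrite (adj _ _ _ _ sE) (index_word_split sE) (index_word_split sb) size_cat /=; lia.
exists true, b, a, c; rewrite ab bc mem_straddle_closure ab bc !mem_inv ab /=.
have sE' : word s = (U ++ b :: V) ++ [:: a, c & W] by rewrite sE -catA.
split=> //; [apply/orP; right|exact: adj sE'|].
  by rewrite (index_word_split sE) (index_word_split sE') size_cat /=; lia.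
by apply: word_inj; rewrite (word_swap sE') -catA.
Qed.

(** The inversion that places [(a, c)] in the closure says on which side of [a]
    and [c] the value [b] stands; since [a] and [c] are adjacent, [b] stands
    before or after both of them. *)
Lemma adjacent_permutree_rule delta up b s (a c : 'I_n) :
    carries up (tnth delta b) -> a < b < c ->
    (a, c) \in straddle_closure up b (inversions s) :\: inversions s ->
    (s^-1)%g c = ((s^-1)%g a).+1 :> nat ->
  permutree_rule delta s (s * tperm a c)%g.
Proof.
move=> db /andP[ab bc]; rewrite in_setD mem_straddle_closure.
case/andP=> /negbTE-> /=; rewrite ab bc /= => bS sca.
have [U [R sE]] : exists U R, word s = U ++ [:: a, c & R].
  exists (take ((s^-1)%g a) (word s)), (drop ((s^-1)%g c).+1 (word s)).
  rewrite [LHS](word_split s a) -sca; congr (_ ++ _ :: _).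
  by rewrite [in LHS](word_split s c) drop_size_cat // size_take size_word ltn_ord.
have pos_a := index_word_split sE.
have : b \in word s by rewrite -index_mem index_word size_word.
rewrite sE mem_cat !in_cons => /or4P[bU|/eqP ba|/eqP bc'|bR].
- case/splitPr: bU sE pos_a => P Q; rewrite -catA cat_cons => sE.
  rewrite size_cat /= => pos_a.
  have pos_b := index_word_split sE.
  case: up db bS => db; rewrite mem_inv => /andP[_ bS]; last by lia.
  apply: (PermutreeUp (b := b) ab bc db sE).
  have -> : P ++ [:: b] ++ Q ++ [:: c; a] ++ R = (P ++ b :: Q) ++ [:: c, a & R].
    by rewrite -catA.
  by apply: word_swap; rewrite -catA.
- by rewrite ba ltnn in ab.
- by rewrite bc' ltnn in bc.
case/splitPr: bR sE => P Q sE.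
have pos_b : (s^-1)%g b = size (U ++ [:: a, c & P]) :> nat.
  by apply: (@index_word_split _ _ _ _ Q); rewrite -catA.
move: pos_b; rewrite size_cat /= => pos_b.
case: up db bS => db; rewrite mem_inv => /andP[_ bS]; first by lia.
exact: (PermutreeDown (b := b) ab bc db sE (word_swap sE)).
Qed.

(** Each swap of an adjacent missing pair is a rewriting that keeps the closure
    and brings the inversion set one pair closer to it. *)
Lemma congruence_straddle_closure delta up b s u :
    carries up (tnth delta b) -> inversions u = straddle_closure up b (inversions s) ->
  permutree_congruence delta s u.
Proof.
move=> db; have [m] := ubnP #|inversions u :\: inversions s|.
elim: m s => // m IH s lt_m uE.
have [sub|/exists_adjacent_straddle[a [c [abc acD sca]]]] :=
    boolP (straddle_closure up b (inversions s) \subset inversions s).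
  have -> : u = s.
    by apply/inversions_inj/eqP; rewrite uE eqEsubset sub sub_straddle_closure.
  exact: rst_refl.
have ac : a < c by case/andP: abc; exact: ltn_trans.
have [acN acS] := setDP acD.
apply: (rst_trans _ _ _ (s * tperm a c)%g).
  exact/rst_step/(adjacent_permutree_rule db abc acD sca).
apply: IH; last by rewrite (straddle_closure_swap abc).
rewrite -ltnS; apply: leq_trans lt_m; rewrite ltnS inversions_swap //.
apply: proper_card; apply/properP; split; first exact/setDS/subsetUr.
by exists (a, c); rewrite ?uE // in_setD in_setU1 eqxx.
Qed.

Lemma congruence_join_step delta x x' y : permutree_rule delta x x' ->
  permutree_congruence delta (weak_join x y) (weak_join x' y).
Proof.
case/permutree_rule_adjacent=> up [b [a [c [db abc acS sca ->]]]].
have [u uE] := straddle_closure_inversions up b (weak_join x y).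
apply: (rst_trans _ _ _ u); first exact: congruence_straddle_closure db uE.
apply/rst_sym/(congruence_straddle_closure db); rewrite uE.
by apply: straddle_closure_join; rewrite (straddle_closure_swap abc).
Qed.

Lemma weak_joinC x y : weak_join x y = weak_join y x.
Proof.
have [xl yl] := weak_le_join x y; have [yr xr] := weak_le_join y x.
by apply: weak_le_anti; rewrite !weak_joinP xl yl xr yr.
Qed.

Lemma congruence_join delta x x' y y' :
    permutree_congruence delta x x' -> permutree_congruence delta y y' ->
  permutree_congruence delta (weak_join x y) (weak_join x' y').
Proof.
have left z z' t : permutree_congruence delta z z' ->
    permutree_congruence delta (weak_join z t) (weak_join z' t).
  elim=> [{}z {}z' /congruence_join_step//|{}z|{}z {}z' _|z1 z2 z3 _ h1 _ h2].
  - exact: rst_refl.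
  - exact: rst_sym.
  - exact: rst_trans h1 h2.
move=> /(left _ _ y) xx' /(left _ _ x') yy'; apply: rst_trans xx' _.
by rewrite ![weak_join x' _]weak_joinC.
Qed.

(** * Compatibility with meets, by reversal of words *)

Definition flip_decoration (d : decoration) :=
  match d with DecD => DecU | DecU => DecD | _ => d end.

Lemma flip_decorationK : involutive flip_decoration.
Proof. by case. Qed.

(** Reversal turns [a c] into [c a] and moves [b] to the other side of both, so
    it reverses the direction of the rewriting and exchanges its two kinds. *)
Lemma permutree_rule_rev delta s t : permutree_rule delta s t ->
  permutree_rule (map_tuple flip_decoration delta) (weak_rev t) (weak_rev s).
Proof.
case=> U V W a b c ab bc db sE tE.
  apply: (@PermutreeUp _ _ _ _ (rev W) (rev V) (rev U) a b c) => //.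
  - by rewrite tnth_map; case: (tnth delta b) db.
  - by rewrite word_rev tE !rev_cat -!catA.
  - by rewrite word_rev sE !rev_cat -!catA.
apply: (@PermutreeDown _ _ _ _ (rev W) (rev V) (rev U) a b c) => //.
- by rewrite tnth_map; case: (tnth delta b) db.
- by rewrite word_rev tE !rev_cat -!catA.
- by rewrite word_rev sE !rev_cat -!catA.
Qed.

Lemma congruence_rev delta s t : permutree_congruence delta s t ->
  permutree_congruence (map_tuple flip_decoration delta) (weak_rev s) (weak_rev t).
Proof.
elim=> [{}s {}t /permutree_rule_rev r|{}s|{}s {}t _|r1 r2 r3 _ h1 _ h2].
- exact/rst_sym/rst_step.
- exact: rst_refl.
- exact: rst_sym.
- exact: rst_trans h1 h2.
Qed.

Lemma congruence_meet delta x x' y y' :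
    permutree_congruence delta x x' -> permutree_congruence delta y y' ->
  permutree_congruence delta (weak_meet x y) (weak_meet x' y').
Proof.
move=> /congruence_rev xx' /congruence_rev yy'.
have := congruence_rev (congruence_join xx' yy').
suff -> : map_tuple flip_decoration (map_tuple flip_decoration delta) = delta by [].
by apply: val_inj; apply: mapK flip_decorationK _.
Qed.

End Congruence.

Theorem proposition13 (n : nat) (delta : n.-tuple decoration) :
  lattice_congruence (permutree_congruence delta).
Proof.
split.
  split; [exact: rst_refl | exact: rst_trans | exact: rst_sym].
by move=> x x' y y' xx' yy'; split; [exact: congruence_meet | exact: congruence_join].
Qed.
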